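(* Let $k_1,k_2\ge 1$ be integers, let $a,b,c_1,c_2\in\mathbb{C}$, let $t_1,t_2$ be complex variables, and let $\mathcal{F}^{(1)}_4=\mathcal{F}^{(1)}_4(a,b;c_1,c_2;t_1,t_2,k_1,k_2,x,y)$ be the first discrete Appell function. Then $\mathcal{F}^{(1)}_4$ satisfies the two difference equations $$\left[\Theta_{t_1}\left(\tfrac{1}{k_1}\Theta_{t_1}+c_1-1\right)-k_1(-1)^{k_1}(-t_1)_{k_1}\,x\,\rho_{t_1}^{k_1}\left(\tfrac{1}{k_1}\Theta_{t_1}+\tfrac{1}{k_2}\Theta_{t_2}+a\right)\left(\tfrac{1}{k_1}\Theta_{t_1}+\tfrac{1}{k_2}\Theta_{t_2}+b\right)\right]\mathcal{F}^{(1)}_4=0,$$ $$\left[\Theta_{t_2}\left(\tfrac{1}{k_2}\Theta_{t_2}+c_2-1\right)-k_2(-1)^{k_2}(-t_2)_{k_2}\,y\,\rho_{t_2}^{k_2}\left(\tfrac{1}{k_1}\Theta_{t_1}+\tfrac{1}{k_2}\Theta_{t_2}+a\right)\left(\tfrac{1}{k_1}\Theta_{t_1}+\tfrac{1}{k_2}\Theta_{t_2}+b\right)\right]\mathcal{F}^{(1)}_4=0.$$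
   Context: For $a\in\mathbb{C}$ the shifted factorial is $(a)_0=1$ and $(a)_l=a(a+1)\cdots(a+l-1)$ for $l\ge1$. For complex $a,b,c_1,c_2,t_1,t_2$ with $\Re(c_1),\Re(c_2)\ne 0,-1,-2,\dots$ and natural numbers $k_1,k_2$, the first discrete Appell function is $$\mathcal{F}^{(1)}_4(a,b;c_1,c_2;t_1,t_2,k_1,k_2,x,y)=\sum_{m,n\ge0}\frac{(a)_{m+n}(b)_{m+n}(-1)^{mk_1}(-t_1)_{mk_1}(-1)^{nk_2}(-t_2)_{nk_2}}{(c_1)_m(c_2)_n\,m!\,n!}\,x^my^n.$$ The series is regarded as an absolutely convergent function of its last two arguments $x,y$ in the region $\sqrt{|x|}+\sqrt{|y|}<1$. For a function $f$ of $t$: $\Delta_tf(t)=f(t+1)-f(t)$, $\rho_tf(t)=f(t-1)$, $\rho_t^k$ is the $k$-fold iterate, and $\Theta_t=t\,\rho_t\,\Delta_t$, i.e. $\Theta_tf(t)=t\,(f(t)-f(t-1))$. In a product of operators the rightmost acts first; $(-t_i)_{k_i}$, $x$, $y$ and scalars act by multiplication.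
   Formalization: The series diverges for generic complex t_1,t_2 (e.g. a=b=c_1=c_2=k_1=k_2=1, t_1=t_2=1/2, x=y=1/16), so the equations are asserted at those (t_1,t_2,x,y) in the region where the double series converges absolutely. *)

(* Defs.v *)
From HB Require Import structures.
From mathcomp Require Import all_boot all_order all_algebra.
From mathcomp Require Import finmap.
From mathcomp Require Import all_classical all_reals all_analysis.
From mathcomp Require Import complex.
From mathcomp Require summability.

Set Implicit Arguments.
Unset Strict Implicit.
Unset Printing Implicit Defensive.

Import Order.TTheory GRing.Theory Num.Theory.
Import numFieldNormedType.Exports.

Local Open Scope ring_scope.
Local Open Scope complex_scope.

Definition shifted_factorial (F : fieldType) (a : F) (l : nat) : F :=
  \prod_(i < l) (a + i%:R).

(** Complex modulus with values in [R]; the library norm [`|z|] of [R[i]]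
    takes its values in [R[i]]. *)
Definition cmod (R : rcfType) (z : R[i]) : R := complex.Re `|z|.

Section DiscreteAppell.
Variable R : realType.

Definition F4_term (a b c1 c2 t1 t2 : R[i]) (k1 k2 : nat) (x y : R[i])
    (p : nat * nat) : R[i] :=
  let: (m, n) := p in
  shifted_factorial a (m + n) * shifted_factorial b (m + n)
  * ((-1) ^+ (m * k1) * shifted_factorial (- t1) (m * k1))
  * ((-1) ^+ (n * k2) * shifted_factorial (- t2) (n * k2))
  / (shifted_factorial c1 m * shifted_factorial c2 n * m`!%:R * n`!%:R)
  * (x ^+ m * y ^+ n).

Definition F4_abs_cvg (a b c1 c2 t1 t2 : R[i]) (k1 k2 : nat) (x y : R[i])
    : Prop :=
  summable [set: nat * nat]
    (fun p => (cmod (F4_term a b c1 c2 t1 t2 k1 k2 x y p))%:E).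

(** Unordered sum over [nat * nat], i.e. the limit of the finite partial sums;
    [F4_abs_cvg] guarantees that this limit exists, and like every [lim] it has
    an unspecified meaning otherwise. The algebra [R[i]^o] is [R[i]] with its
    structure of normed module over itself. *)
Definition F4 (a b c1 c2 t1 t2 : R[i]) (k1 k2 : nat) (x y : R[i])
    : R[i] :=
  summability.sum (F4_term a b c1 c2 t1 t2 k1 k2 x y : nat * nat -> R[i]^o).

End DiscreteAppell.

Section DifferenceOperators.
Variable C : fieldType.
Implicit Types (f : C -> C) (g : C -> C -> C).

Definition Delta f : C -> C := fun t => f (t + 1) - f t.
Definition rho f : C -> C := fun t => f (t - 1).
Definition Theta f : C -> C := fun t => t * rho (Delta f) t.

(** A one-variable operator acting on the first, resp. second, argument. *)
Definition on_fst (L : (C -> C) -> C -> C) g : C -> C -> C :=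
  fun t1 t2 => L (fun s => g s t2) t1.
Definition on_snd (L : (C -> C) -> C -> C) g : C -> C -> C :=
  fun t1 t2 => L (fun s => g t1 s) t2.

Definition Theta1 g : C -> C -> C := on_fst Theta g.
Definition Theta2 g : C -> C -> C := on_snd Theta g.
Definition rho1 g : C -> C -> C := on_fst rho g.
Definition rho2 g : C -> C -> C := on_snd rho g.

(** [k1^-1 Theta1 + k2^-1 Theta2 + u] *)
Definition Theta12 (k1 k2 : nat) (u : C) g : C -> C -> C :=
  fun t1 t2 =>
    k1%:R^-1 * Theta1 g t1 t2 + k2%:R^-1 * Theta2 g t1 t2 + u * g t1 t2.

Definition F4_op1 (a b c1 : C) (k1 k2 : nat) (x : C) g : C -> C -> C :=
  fun t1 t2 =>
    Theta1 (fun s1 s2 => k1%:R^-1 * Theta1 g s1 s2 + (c1 - 1) * g s1 s2) t1 t2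
    - k1%:R * (-1) ^+ k1 * shifted_factorial (- t1) k1 * x
      * iter k1 rho1 (Theta12 k1 k2 a (Theta12 k1 k2 b g)) t1 t2.

Definition F4_op2 (a b c2 : C) (k1 k2 : nat) (y : C) g : C -> C -> C :=
  fun t1 t2 =>
    Theta2 (fun s1 s2 => k2%:R^-1 * Theta2 g s1 s2 + (c2 - 1) * g s1 s2) t1 t2
    - k2%:R * (-1) ^+ k2 * shifted_factorial (- t2) k2 * y
      * iter k2 rho2 (Theta12 k1 k2 a (Theta12 k1 k2 b g)) t1 t2.

End DifferenceOperators.

(* Main.v *)
Require Import Defs.
From HB Require Import structures.
From mathcomp Require Import all_boot all_order all_algebra.
From mathcomp Require Import finmap.
From mathcomp Require Import all_classical all_reals all_analysis.
From mathcomp Require Import complex.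
From mathcomp Require summability.
From mathcomp Require Import ring lra.

Set Implicit Arguments.
Unset Strict Implicit.
Unset Printing Implicit Defensive.

Import Order.TTheory GRing.Theory Num.Theory.

Local Open Scope ring_scope.

(** The idea is that the series converges absolutely only when it terminates,
    so that the theorem is one about finite sums.

    Up to the sign absorbed in [falling], the factor of the general term that
    depends on [t1] is the falling factorial
    [t1 (t1 - 1) ... (t1 - m k1 + 1)], and the operators act on it simply:
    [Theta1 / k1] multiplies it by [m] (lemma [Theta_falling]), while a shift by
    [k1] followed by multiplication by the falling factorial of length [k1]
    replaces [m] by [m + 1] (lemma [fallingD]). Since the coefficients of the
    series satisfy the hypergeometric recurrence [F4_coef_rec], the second
    summand of the operator is the first one shifted by one step in [m], and the
    sum over [m] telescopes ([F4_op1_expands_eq0]).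

    Convergence is assumed at [(t1, t2)] alone, whereas the operators also
    evaluate the series at shifted arguments. Along [n = 0] the modulus of the
    ratio of consecutive terms tends to infinity, because [(a + m) (b + m)] and
    [(c1 + m) (m + 1)] balance and the falling factorial contributes [k1]
    further factors of order [m]. Hence convergence forces all but finitely many
    of these terms to vanish ([hypergeometric_unbounded],
    [F4_bounded_terminates]): either [a] or [b] is a nonpositive integer, or
    [x = 0], or [t1] is a natural number; likewise for [y] and [t2]. In the
    first cases the series terminates whatever the value of [t1], and in the
    last one it does so at [t1], [t1 - 1], ..., [0]. Either way the arguments for
    which it terminates include, with each [s != 0], also [s - 1]
    ([F4_terminates_domain]); and [Theta], through its factor [t], never sees
    the value to the left of [0]. On such a domain the series is a finite double
    sum ([F4_expands]) and the telescoping applies. The second equation is the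
    first one with the two variables exchanged. *)

(** * Falling factorials *)

Section FallingFactorial.
Variable C : fieldType.
Implicit Types (a s t : C) (k l m n : nat).

Lemma shifted_factorialS a l :
  shifted_factorial a l.+1 = shifted_factorial a l * (a + l%:R).
Proof. by rewrite /shifted_factorial big_ord_recr. Qed.

Lemma shifted_factorial_nat_eq0 j l :
  (j < l)%N -> shifted_factorial (- j%:R : C) l = 0.
Proof.
move=> lt_jl; rewrite /shifted_factorial (bigD1 (Ordinal lt_jl)) //=.
by rewrite addNr mul0r.
Qed.

Definition falling t l : C := (-1) ^+ l * shifted_factorial (- t) l.

Lemma falling0 t : falling t 0 = 1.
Proof. by rewrite /falling /shifted_factorial big_ord0 mulr1. Qed.

Lemma fallingS t l : falling t l.+1 = falling t l * (t - l%:R).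
Proof. by rewrite /falling shifted_factorialS exprS; ring. Qed.

Lemma fallingD t k l : falling t (k + l) = falling t k * falling (t - k%:R) l.
Proof.
elim: l => [|l IHl]; first by rewrite addn0 falling0 mulr1.
by rewrite addnS !fallingS IHl natrD; ring.
Qed.

Lemma falling_nat_eq0 j l : (j < l)%N -> falling (j%:R : C) l = 0.
Proof. by move=> lt_jl; rewrite /falling shifted_factorial_nat_eq0 // mulr0. Qed.

(** Both sides come from computing [falling t l.+1] by removing its last factor,
    [t - l], or its first one, [t]. *)
Lemma Theta_falling t l :
  t * (falling t l - falling (t - 1) l) = l%:R * falling t l.
Proof.
have eq_t : falling t l * (t - l%:R) = t * falling (t - 1) l.
  by rewrite -fallingS -add1n fallingD fallingS falling0 !mul1r subr0.
by rewrite mulrBr -eq_t; ring.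
Qed.

End FallingFactorial.

(** * Finite expansions in falling factorials *)

Section Expansions.
Variables (C : fieldType) (k1 k2 N : nat) (D1 D2 : C -> Prop).
Implicit Types (g : C -> C -> C) (w : nat -> nat -> C).

(** The point [0] is exempted because [Theta f 0] does not involve [f (- 1)]. *)
Definition pred_closed (D : C -> Prop) :=
  forall s : C, D s -> s != 0 -> D (s - 1).

Hypothesis D1_pred : pred_closed D1.

(** The equality is asked on [D1 * D2] only: elsewhere the series may diverge and
    its sum is then unrelated to its terms. *)
Definition expands g w :=
  forall s1 s2, D1 s1 -> D2 s2 ->
    g s1 s2 = \sum_(m < N) \sum_(n < N)
      w m n * (falling s1 (m * k1) * falling s2 (n * k2)).

Lemma expands_lin u v g h w z : expands g w -> expands h z ->
  expands (fun s1 s2 => u * g s1 s2 + v * h s1 s2)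
          (fun m n => u * w m n + v * z m n).
Proof.
move=> g_w h_z s1 s2 D1s D2s; rewrite g_w // h_z // !mulr_sumr -big_split /=.
apply: eq_bigr => m _; rewrite !mulr_sumr -big_split /=.
by apply: eq_bigr => n _; ring.
Qed.

(** Falling factorials are eigenfunctions of [Theta]. At [s1 = 0] both sides
    vanish, whatever [g] is at [-1]. *)
Lemma expands_Theta1 g w : expands g w ->
  expands (Theta1 g) (fun m n => (m * k1)%:R * w m n).
Proof.
move=> g_w s1 s2 D1s D2s.
rewrite /Theta1 /on_fst /Theta /rho /Delta subrK.
have termE (m n : nat) :
  (m * k1)%:R * w m n * (falling s1 (m * k1) * falling s2 (n * k2))
  = s1 * (w m n * (falling s1 (m * k1) * falling s2 (n * k2))
          - w m n * (falling (s1 - 1) (m * k1) * falling s2 (n * k2))).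
  transitivity (w m n * falling s2 (n * k2)
                * ((m * k1)%:R * falling s1 (m * k1))); first by ring.
  by rewrite -Theta_falling; ring.
under eq_bigr => m _ do under eq_bigr => n _ do rewrite termE.
have [->|s1_neq0] := eqVneq s1 0.
  rewrite mul0r big1 // => m _; rewrite big1 // => n _.
  by rewrite mul0r.
rewrite g_w // g_w //; last exact: D1_pred.
rewrite -sumrB mulr_sumr; apply: eq_bigr => m _.
by rewrite -sumrB mulr_sumr.
Qed.

End Expansions.

Lemma expands_swap (C : fieldType) (k1 k2 N : nat) (D1 D2 : C -> Prop)
    g w : expands k1 k2 N D1 D2 g w ->
  expands k2 k1 N D2 D1 (fun s2 s1 => g s1 s2) (fun n m => w m n).
Proof.
move=> g_w s2 s1 D2s D1s; rewrite g_w // exchange_big /=.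
by apply: eq_bigr => n _; apply: eq_bigr => m _; congr (_ * _); rewrite mulrC.
Qed.

(** * The telescoping sum *)

Section Operators.
Variables (C : fieldType) (k1 k2 N : nat) (D1 D2 : C -> Prop).
Implicit Types (g : C -> C -> C) (w : nat -> nat -> C).

Hypotheses (D1_pred : pred_closed D1) (D2_pred : pred_closed D2).
Hypotheses (k1_neq0 : k1%:R != 0 :> C) (k2_neq0 : k2%:R != 0 :> C).

Lemma expands_Theta12 u g w : expands k1 k2 N D1 D2 g w ->
  expands k1 k2 N D1 D2 (Theta12 k1 k2 u g)
          (fun m n => ((m + n)%:R + u) * w m n).
Proof.
move=> g_w.
have Theta2_g : expands k1 k2 N D1 D2 (Theta2 g)
                  (fun m n => (n * k2)%:R * w m n).
  exact: expands_swap (expands_Theta1 D2_pred (expands_swap g_w)).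
have T12 := expands_lin k1%:R^-1 k2%:R^-1
  (expands_Theta1 D1_pred g_w) Theta2_g.
move=> s1 s2 D1s D2s; have := expands_lin 1 u T12 g_w D1s D2s.
rewrite /= mul1r /Theta12 => ->; apply: eq_bigr => m _; apply: eq_bigr => n _.
congr (_ * _); rewrite !natrM natrD.
by field; rewrite k1_neq0 k2_neq0.
Qed.

Lemma iter_rho1 l g t1 t2 : iter l (@rho1 C) g t1 t2 = g (t1 - l%:R) t2.
Proof.
elim: l t1 => [|l IHl] t1 /=; first by rewrite subr0.
by rewrite /rho1 /on_fst /rho IHl -addn1 natrD opprD addrA addrAC.
Qed.

(** A nonzero falling factorial has no zero factor, so no step of the descent
    from [t] to [t - l] starts at the exempted point [0]. *)
Lemma pred_closed_falling t l : D1 t -> falling t l != 0 -> D1 (t - l%:R).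
Proof.
move=> D1t; elim: l => [|l IHl]; first by rewrite subr0.
rewrite fallingS mulf_eq0 negb_or => /andP[/IHl D1tl tl_neq0].
by rewrite -addn1 natrD opprD addrA; apply: D1_pred.
Qed.

(** Let [G m] be [k1] times the part of index [m] of the expansion, multiplied
    by [m (m + c - 1)]. Then [Theta1 (Theta1 / k1 + c - 1) g] is the sum of the
    [G m], the other summand of the operator is the sum of the [G m.+1] by the
    recurrence, and the difference is [G 0 - G N], whose first term has a factor
    [0] and whose second one is killed by the boundary hypothesis. *)
Lemma F4_op1_expands_eq0 (a b c x t1 t2 : C) g w :
  expands k1 k2 N D1 D2 g w ->
  (forall m n, m.+1%:R * (m%:R + c) * w m.+1 n
               = x * ((m + n)%:R + a) * ((m + n)%:R + b) * w m n) ->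
  D1 t1 -> D2 t2 ->
  (forall n, w N n * (falling t1 (N * k1) * falling t2 (n * k2)) = 0) ->
  F4_op1 a b c k1 k2 x g t1 t2 = 0.
Proof.
move=> g_w w_rec D1t D2t w_end.
pose G m := k1%:R * \sum_(n < N) m%:R * (m%:R + c - 1) * w m n
  * (falling t1 (m * k1) * falling t2 (n * k2)).
have -> : F4_op1 a b c k1 k2 x g t1 t2 = \sum_(m < N) (G m - G m.+1).
  rewrite sumrB /F4_op1; congr (_ - _).
    have g_Th := expands_lin k1%:R^-1 (c - 1) (expands_Theta1 D1_pred g_w) g_w.
    rewrite (expands_Theta1 D1_pred g_Th) //; apply: eq_bigr => m _.
    rewrite /G mulr_sumr; apply: eq_bigr => n _.
    by rewrite !natrM; field.
  have g_Th := expands_Theta12 a (expands_Theta12 b g_w).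
  rewrite iter_rho1 -(mulrA k1%:R) -/(falling t1 k1).
  transitivity (\sum_(m < N) \sum_(n < N) k1%:R * x *
     (((m + n)%:R + a) * (((m + n)%:R + b) * w m n) *
      (falling t1 (k1 + m * k1) * falling t2 (n * k2)))).
    (* If the prefactor vanishes, [t1 - k1] may lie outside [D1], but then the
       value of [g] there is irrelevant. *)
    have [t_eq0|t_neq0] := eqVneq (falling t1 k1) 0.
      rewrite t_eq0 mulr0 !mul0r big1 // => m _; rewrite big1 // => n _.
      by rewrite fallingD t_eq0 !mul0r !mulr0.
    rewrite g_Th //; last exact: pred_closed_falling.
    rewrite mulr_sumr; apply: eq_bigr => m _.
    rewrite mulr_sumr; apply: eq_bigr => n _.
    by rewrite fallingD; ring.
  apply: eq_bigr => m _; rewrite /G mulr_sumr; apply: eq_bigr => n _.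
  have -> : m.+1%:R + c - 1 = m%:R + c by rewrite -addn1 natrD; ring.
  by rewrite w_rec -mulSn; ring.
rewrite -(big_mkord xpredT (fun m => G m - G m.+1)).
under eq_bigr => m _ do rewrite -opprB.
rewrite sumrN telescope_sumr // /G big1 ?mulr0.
  by rewrite big1 ?mulr0 ?subrr ?oppr0 // => n _; rewrite !mul0r.
by move=> n _; rewrite -mulrA w_end mulr0.
Qed.

Lemma iter_rho2 l g t1 t2 : iter l (@rho2 C) g t1 t2 = g t1 (t2 - l%:R).
Proof.
elim: l t2 => [|l IHl] t2 /=; first by rewrite subr0.
by rewrite /rho2 /on_snd /rho IHl -addn1 natrD opprD addrA addrAC.
Qed.

Lemma Theta12_swap u g :
  Theta12 k1 k2 u g
  = fun s1 s2 => Theta12 k2 k1 u (fun s2 s1 => g s1 s2) s2 s1.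
Proof.
apply/funext => s1; apply/funext => s2.
by rewrite /Theta12 (addrC (k1%:R^-1 * _)).
Qed.

Lemma F4_op2_swap (a b c y t1 t2 : C) g :
  F4_op2 a b c k1 k2 y g t1 t2
  = F4_op1 a b c k2 k1 y (fun s2 s1 => g s1 s2) t2 t1.
Proof.
by rewrite /F4_op2 /F4_op1 iter_rho1 iter_rho2 (Theta12_swap b) (Theta12_swap a).
Qed.

End Operators.

(** * The terms of the series *)

Local Open Scope complex_scope.

Section Terms.
Variable R : realType.
Implicit Types (a b c x y t s : R[i]) (k m n N : nat).

Definition F4_coef a b c1 c2 x y m n : R[i] :=
  shifted_factorial a (m + n) * shifted_factorial b (m + n)
  / (shifted_factorial c1 m * shifted_factorial c2 n * m`!%:R * n`!%:R)
  * (x ^+ m * y ^+ n).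

Lemma F4_termE a b c1 c2 t1 t2 k1 k2 x y m n :
  F4_term a b c1 c2 t1 t2 k1 k2 x y (m, n)
  = F4_coef a b c1 c2 x y m n * (falling t1 (m * k1) * falling t2 (n * k2)).
Proof. by rewrite /F4_term /F4_coef /falling; ring. Qed.

Lemma F4_coefC a b c1 c2 x y m n :
  F4_coef a b c1 c2 x y m n = F4_coef a b c2 c1 y x n m.
Proof.
rewrite /F4_coef (addnC n m) (mulrC (y ^+ n)); congr (_ / _ * _).
by ring.
Qed.

Lemma F4_termC a b c1 c2 t1 t2 k1 k2 x y m n :
  F4_term a b c1 c2 t1 t2 k1 k2 x y (m, n)
  = F4_term a b c2 c1 t2 t1 k2 k1 y x (n, m).
Proof. by rewrite !F4_termE F4_coefC (mulrC (falling t1 _)). Qed.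

Lemma F4_coef_rec a b c1 c2 x y m n : (forall j : nat, c1 + j%:R != 0) ->
  m.+1%:R * (m%:R + c1) * F4_coef a b c1 c2 x y m.+1 n
  = x * ((m + n)%:R + a) * ((m + n)%:R + b) * F4_coef a b c1 c2 x y m n.
Proof.
move=> c1_neq; rewrite /F4_coef addSn !shifted_factorialS factS natrM exprS.
have m1_neq0 : m.+1%:R != 0 :> R[i] by rewrite pnatr_eq0.
rewrite !invfM.
have c1mK : (m%:R + c1) / (c1 + m%:R) = 1.
  by rewrite addrC mulfV ?c1_neq.
have m1K := mulfV m1_neq0.
set A := shifted_factorial a _; set B := shifted_factorial b _.
set P := (shifted_factorial c1 m)^-1; set Q := (shifted_factorial c2 n)^-1.
set U := (m`!%:R)^-1; set V := (n`!%:R)^-1.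
transitivity ((m%:R + c1) / (c1 + m%:R) * (m.+1%:R / m.+1%:R)
  * (x * ((m + n)%:R + a) * ((m + n)%:R + b)
     * (A * B * (P * Q * U * V) * (x ^+ m * y ^+ n)))); first by ring.
by rewrite c1mK m1K !mul1r.
Qed.

(** The cases in which all terms with [m] large vanish. *)
Definition F4_terminates a b x t :=
  exists j : nat, [\/ a = - j%:R, b = - j%:R, x = 0 | t = j%:R].

(** If [t = j], the domain is [{0, ..., j}]; in the three other cases the vanishing
    does not depend on the argument and the domain is everything. *)
Lemma F4_terminates_domain a b x t k : (0 < k)%N -> F4_terminates a b x t ->
  exists N (D : R[i] -> Prop), [/\ D t, pred_closed D &
    forall c1 c2 y s m n, D s -> (N <= m)%N ->
      F4_coef a b c1 c2 x y m n * falling s (m * k) = 0].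
Proof.
move=> k_gt0 [j].
have sf0 m n : (j < m)%N -> shifted_factorial (- j%:R : R[i]) (m + n) = 0.
  by move=> lt_jm; apply: shifted_factorial_nat_eq0; apply: ltn_addr.
rewrite /F4_coef; case=> [->|->|->|->].
- by exists j.+1, (fun=> True); split=> // *; rewrite sf0 // !mul0r.
- by exists j.+1, (fun=> True); split=> // *; rewrite sf0 // mulr0 !mul0r.
- exists 1%N, (fun=> True); split=> // c1 c2 y s m n _ m_gt0.
  by rewrite expr0n gtn_eqF // mul0r mulr0 mul0r.
- exists j.+1, (fun s => exists2 i : nat, (i <= j)%N & s = i%:R); split.
  + by exists j.
  + move=> _ [[|i] le_ij ->]; first by rewrite eqxx.
    by move=> _; exists i; [apply: ltnW | rewrite -addn1 natrD addrK].
  + move=> c1 c2 y _ m n [i le_ij ->] lt_jm; rewrite falling_nat_eq0 ?mulr0 //.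
    apply: leq_ltn_trans le_ij (leq_trans lt_jm _).
    by rewrite leq_pmulr.
Qed.

(** The partial sums are constant as soon as they contain the box [N * N]. *)
Lemma sum_finite_box (f : nat * nat -> R[i]) N :
  (forall m n, (N <= m)%N || (N <= n)%N -> f (m, n) = 0) ->
  summability.sum (f : nat * nat -> R[i]^o)
  = \sum_(m < N) \sum_(n < N) f (nat_of_ord m, nat_of_ord n).
Proof.
move=> f0.
pose s := [seq (m, n) | m <- iota 0 N, n <- iota 0 N].
have s_uniq : uniq s.
  by rewrite allpairs_uniq ?iota_uniq // => -[? ?] [? ?].
have s_mem m n : ((m, n) \in s) = (m < N)%N && (n < N)%N.
  apply/allpairsP/andP => [[[i j] /= []]|[lt_mN lt_nN]].
    by rewrite !mem_iota /= => ? ? [-> ->].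
  by exists (m, n); rewrite !mem_iota.
pose A := seq_fset tt s.
have -> : \sum_(m < N) \sum_(n < N) f (nat_of_ord m, nat_of_ord n)
          = \sum_(p <- A) f p.
  have sA_perm : perm_eq A s.
    by have := seq_fset_perm tt s; rewrite undup_id.
  rewrite (perm_big _ sA_perm).
  rewrite big_allpairs -(big_mkord xpredT (fun m => \sum_(n < N) f (m, _))).
  rewrite /index_iota subn0; apply: eq_bigr => m _.
  by rewrite -(big_mkord xpredT (fun n => f (m, n))) /index_iota subn0.
apply: (cvg_lim (@norm_hausdorff _ (R[i]^o))); [exact: summability.totally_filter|].
apply: (@cvg_near_cst _ _ _ _ _ summability.totally_filter).
exists A => // B /= sAB.
rewrite /summability.partial_sum -(big_seq_fsetE _ _ xpredT f).
symmetry; apply: (big_fset_incl _ sAB) => -[m n] _.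
by rewrite seq_fsetE s_mem negb_and -!leqNgt => /f0.
Qed.

Lemma F4_expands a b c1 c2 k1 k2 x y N (D1 D2 : R[i] -> Prop) :
  (forall s m n, D1 s -> (N <= m)%N ->
    F4_coef a b c1 c2 x y m n * falling s (m * k1) = 0) ->
  (forall s m n, D2 s -> (N <= n)%N ->
    F4_coef a b c1 c2 x y m n * falling s (n * k2) = 0) ->
  expands k1 k2 N D1 D2 (fun s1 s2 => F4 a b c1 c2 s1 s2 k1 k2 x y)
    (F4_coef a b c1 c2 x y).
Proof.
move=> van1 van2 s1 s2 D1s D2s; rewrite /F4 (sum_finite_box (N := N)).
  by apply: eq_bigr => m _; apply: eq_bigr => n _; rewrite F4_termE.
move=> m n; rewrite F4_termE => /orP[le_Nm|le_Nn].
  by rewrite mulrA van1 // mul0r.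
by rewrite mulrCA van2 // mulr0.
Qed.

End Terms.

(** * Absolute convergence forces termination *)

Section Divergence.
Variable R : realType.
Implicit Types (a b c x y t z : R[i]) (k m n : nat).

Lemma cmodM z t : cmod (z * t) = cmod z * cmod t.
Proof. exact: ComplexField.Normc.normcM. Qed.

Lemma cmodN z : cmod (- z) = cmod z.
Proof. by rewrite /cmod normrN. Qed.

Lemma cmod_nat n : cmod (n%:R : R[i]) = n%:R.
Proof. by rewrite /cmod normr_nat -(rmorph_nat (real_complex R)). Qed.

Lemma cmod_gt0 z : z != 0 -> 0 < cmod z.
Proof.
move=> z_neq0; rewrite lt_def; apply/andP; split.
  by apply: contra_neq z_neq0 => /ComplexField.Normc.eq0_normc.
have := normr_ge0 z; rewrite lecE /= => /andP[_]; exact.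
Qed.

Lemma cmod_ge0 z : 0 <= cmod z.
Proof. by have := normr_ge0 z; rewrite lecE /= => /andP[_]; exact. Qed.

Lemma cmodD z t : cmod (z + t) <= cmod z + cmod t.
Proof. exact: le_normcD. Qed.

Lemma cmod_natD_ge n z : n%:R - cmod z <= cmod (n%:R + z).
Proof.
have := cmodD (n%:R + z) (- z).
by rewrite addrK cmodN cmod_nat lerBlDr.
Qed.

Lemma cmod_natD_le n z : cmod (n%:R + z) <= n%:R + cmod z.
Proof. by have := cmodD n%:R z; rewrite cmod_nat. Qed.

Lemma cmod_falling_ge1 t n l :
  cmod t + 1 <= n%:R -> 1 <= cmod (falling (t - n%:R) l).
Proof.
move=> le_tn; elim: l => [|l IHl]; first by rewrite falling0 (cmod_nat 1).
rewrite fallingS cmodM -[leLHS]mulr1; apply: ler_pM => //.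
rewrite -cmodN !opprB addrA -natrD.
have := cmod_natD_ge (l + n) (- t); rewrite cmodN natrD.
have : 0 <= l%:R :> R by [].
by lra.
Qed.

Lemma geometric_unbounded (u : nat -> R) m0 M :
  (forall m, 0 < u m) -> (forall m, (m0 <= m)%N -> 2 * u m <= u m.+1) ->
  exists m, M < u m.
Proof.
move=> u_gt0 u_grow.
have u_ge i : i%:R * u m0 <= u (m0 + i)%N.
  elim: i => [|i IHi]; first by rewrite mul0r ltW.
  have u_mono : u m0 <= u (m0 + i)%N.
    elim: i {IHi} => [|i IHi]; first by rewrite addn0.
    have := u_grow (m0 + i)%N (leq_addr _ _); rewrite -addnS.
    by have := u_gt0 (m0 + i)%N; lra.
  have := u_grow (m0 + i)%N (leq_addr _ _); rewrite -addnS -addn1 natrD.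
  by rewrite mulrDl; lra.
have [i lt_Mi] : exists i : nat, M / u m0 < i%:R.
  exists (Num.bound `|M / u m0|).
  exact: le_lt_trans (ler_norm _) (archi_boundP (normr_ge0 _)).
exists (m0 + i)%N; apply: lt_le_trans (u_ge i).
by rewrite -ltr_pdivrMr.
Qed.

(** For [m] large with respect to the parameters, [|m + a|], [|m + b|] and the
    modulus of the falling factorial are at least [m / 2], whereas [|m + c|] and
    [m + 1] are at most [2 m]. So the ratio of consecutive terms is at least
    [|x| m / 32], and this is at least [2] once [m >= 64 / |x|]. *)
Lemma hypergeometric_unbounded a b c x t k (u : nat -> R[i]) M :
  (0 < k)%N -> x != 0 -> (forall m, u m != 0) ->
  (forall m, m.+1%:R * (m%:R + c) * u m.+1
     = x * (m%:R + a) * (m%:R + b) * falling (t - (m * k)%:R) k * u m) ->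
  exists m, M < cmod (u m).
Proof.
move=> k_gt0 x_neq0 u_neq0 u_rec.
pose K := cmod a + cmod b + cmod c + cmod t.
have cx := cmod_gt0 x_neq0.
pose m0 := (Num.bound (2 * K + 2 + 64 / cmod x)).
apply: (geometric_unbounded (m0 := m0)).
- by move=> i; apply: cmod_gt0.
- move=> m le_m0m.
  have ge0 := (cmod_ge0 a, cmod_ge0 b, cmod_ge0 c, cmod_ge0 t).
  have Kx_ge0 : 0 <= 2 * K + 2 + 64 / cmod x.
    by rewrite !addr_ge0 ?mulr_ge0 ?addr_ge0 ?invr_ge0 ?ge0 // ltW.
  have m_ge : 2 * K + 2 + 64 / cmod x <= m%:R.
    apply: le_trans (ltW (archi_boundP Kx_ge0)) _.
    by rewrite ler_nat.
  have x64_gt0 : 0 < 64 / cmod x by rewrite divr_gt0.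
  rewrite /K in m_ge; case: ge0 => [[[a_ge0 b_ge0] c_ge0] t_ge0].
  have xm_ge : 64 <= cmod x * m%:R by rewrite mulrC -ler_pdivrMr //; lra.
  have m_gt0 : 0 < m%:R :> R by lra.
  have am_ge : m%:R / 2 <= cmod (m%:R + a).
    by have := cmod_natD_ge m a; lra.
  have bm_ge : m%:R / 2 <= cmod (m%:R + b).
    by have := cmod_natD_ge m b; lra.
  have cm_le : cmod (m%:R + c) <= 2 * m%:R.
    by have := cmod_natD_le m c; lra.
  have fall_ge : m%:R / 2 <= cmod (falling (t - (m * k)%:R) k).
    case: k k_gt0 {u_rec} => // l _.
    have mk_ge : m%:R <= (m * l.+1)%:R :> R by rewrite ler_nat leq_pmulr.
    (* The last factor is of order [m]; the product of the others has modulus at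
       least [1]. *)
    rewrite fallingS cmodM -[leLHS]mul1r; apply: ler_pM => //.
      by apply: cmod_falling_ge1; lra.
    rewrite -cmodN !opprB addrA -natrD.
    have := cmod_natD_ge (l + m * l.+1) (- t); rewrite cmodN natrD.
    have : 0 <= l%:R :> R by [].
    by lra.
  set X := cmod x in cx xm_ge *; set A := cmod (_ + a) in am_ge.
  set B := cmod (_ + b) in bm_ge; set G := cmod _ in fall_ge.
  set E := cmod (_ + c) in cm_le.
  have eq_u : m.+1%:R * E * cmod (u m.+1) = X * A * B * G * cmod (u m).
    by rewrite -(cmod_nat m.+1) -!cmodM u_rec.
  have [um um1] := (cmod_ge0 (u m), cmod_ge0 (u m.+1)).
  have num_ge : 8 * m%:R ^+ 2 <= X * A * B * G.
    have AB : (m%:R / 2) * (m%:R / 2) <= A * B by apply: ler_pM => //; lra.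
    have ABG : (m%:R / 2) * (m%:R / 2) * (m%:R / 2) <= A * B * G.
      by apply: ler_pM => //; rewrite ?mulr_ge0 //; lra.
    have XABG : X * (m%:R / 2 * (m%:R / 2) * (m%:R / 2)) <= X * (A * B * G).
      by rewrite ler_pM2l.
    have m2 := ler_wpM2r (sqr_ge0 m%:R) xm_ge.
    by rewrite -/X in m2; lra.
  have den_le : m.+1%:R * E <= 4 * m%:R ^+ 2.
    have : m.+1%:R * E <= (2 * m%:R) * (2 * m%:R).
      apply: ler_pM => //; first exact: cmod_ge0.
      by rewrite -addn1 natrD; lra.
    by lra.
  have m2_gt0 : 0 < 4 * m%:R ^+ 2 :> R by rewrite mulr_gt0 ?exprn_gt0.
  rewrite -(ler_pM2l m2_gt0).
  have := ler_wpM2r um num_ge; have := ler_wpM2r um1 den_le.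
  by lra.
Qed.

Lemma F4_abs_cvg_bounded a b c1 c2 t1 t2 k1 k2 x y :
  F4_abs_cvg a b c1 c2 t1 t2 k1 k2 x y ->
  exists M, forall p, cmod (F4_term a b c1 c2 t1 t2 k1 k2 x y p) <= M.
Proof.
rewrite /F4_abs_cvg; set f := F4_term _ _ _ _ _ _ _ _ _ _ => f_sum.
have f_fin := f_sum; rewrite summableE in f_fin.
exists (fine (\esum_(p in [set: nat * nat]) `|(cmod (f p))%:E|%E)) => p.
rewrite -lee_fin (fineK f_fin); apply: esum_ge.
exists [set p]%classic; first by split=> //; exact: finite_set1.
by rewrite fsbig_set1 lee_abs.
Qed.

(** Were no factor of the numerators zero, the terms with [n = 0] would form a
    nowhere zero, hence unbounded, hypergeometric sequence. *)
Lemma F4_bounded_terminates a b c1 c2 t1 t2 k1 k2 x y M : (0 < k1)%N ->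
  (forall j : nat, c1 + j%:R != 0) ->
  (forall m, cmod (F4_term a b c1 c2 t1 t2 k1 k2 x y (m, 0)) <= M) ->
  F4_terminates a b x t1.
Proof.
move=> k1_gt0 c1_neq bnd; apply: contrapT => not_term.
have a_neq j : j%:R + a != 0.
  rewrite addrC addr_eq0; apply/eqP => a_eq; apply: not_term; exists j.
  exact: Or41.
have b_neq j : j%:R + b != 0.
  rewrite addrC addr_eq0; apply/eqP => b_eq; apply: not_term; exists j.
  exact: Or42.
have x_neq0 : x != 0.
  by apply/eqP => x_eq; apply: not_term; exists 0%N; exact: Or43.
have t_neq j : t1 - j%:R != 0.
  rewrite subr_eq0; apply/eqP => t_eq; apply: not_term; exists j.
  exact: Or44.
pose u m := F4_term a b c1 c2 t1 t2 k1 k2 x y (m, 0%N).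
have u_rec m : m.+1%:R * (m%:R + c1) * u m.+1
  = x * (m%:R + a) * (m%:R + b) * falling (t1 - (m * k1)%:R) k1 * u m.
  have := F4_coef_rec a b c2 x y m 0 c1_neq; rewrite addn0 => w_rec.
  rewrite /u !F4_termE mulSnr fallingD.
  by rewrite mulrA w_rec; ring.
have fall_neq0 n l : falling (t1 - n%:R) l != 0.
  elim: l => [|l IHl]; first by rewrite falling0 oner_eq0.
  by rewrite fallingS mulf_neq0 // -addrA -opprD -natrD.
have u_neq0 m : u m != 0.
  elim: m => [|m IHm].
    rewrite /u F4_termE /F4_coef /shifted_factorial !big_ord0 !falling0.
    by rewrite !expr0 fact0 !mulr1 invr1 mulr1 oner_eq0.
  apply/eqP => u_eq0; have := u_rec m; rewrite u_eq0 mulr0 => /esym/eqP.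
  by apply/negP; do 4!apply: mulf_neq0 => //; apply: fall_neq0.
have [m] := hypergeometric_unbounded M k1_gt0 x_neq0 u_neq0 u_rec.
by rewrite ltNge bnd.
Qed.

End Divergence.

Lemma complex_natD_neq0 (R : realType) (c : R[i]) :
  (forall j : nat, complex.Re c != - j%:R) -> forall j : nat, c + j%:R != 0.
Proof.
move=> Re_c j; apply: contra_neq (Re_c j) => /eqP; rewrite addr_eq0 => /eqP->.
by rewrite -(rmorph_nat (real_complex R)) -rmorphN.
Qed.

(** * The difference equations *)

Theorem mainTheorem1 (R : realType) (k1 k2 : nat)
    (k1_ge1 : (1 <= k1)%N) (k2_ge1 : (1 <= k2)%N)
    (a b c1 c2 : R[i])
    (Re_c1 : forall j : nat, complex.Re c1 != - j%:R)
    (Re_c2 : forall j : nat, complex.Re c2 != - j%:R)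
    (x y : R[i]) (xy_region : Num.sqrt (cmod x) + Num.sqrt (cmod y) < 1)
    (t1 t2 : R[i]) (cvg_F4 : F4_abs_cvg a b c1 c2 t1 t2 k1 k2 x y) :
  let F := fun s1 s2 : R[i] => F4 a b c1 c2 s1 s2 k1 k2 x y in
  F4_op1 a b c1 k1 k2 x F t1 t2 = 0 /\
  F4_op2 a b c2 k1 k2 y F t1 t2 = 0.
Proof.
move=> F.
have c1_neq := complex_natD_neq0 Re_c1; have c2_neq := complex_natD_neq0 Re_c2.
have k_neq0 k : (0 < k)%N -> k%:R != 0 :> R[i] by rewrite pnatr_eq0 lt0n.
have [M bnd] := F4_abs_cvg_bounded cvg_F4.
have term1 : F4_terminates a b x t1.
  by apply: F4_bounded_terminates k1_ge1 c1_neq (fun m => bnd (m, 0%N)).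
have term2 : F4_terminates a b y t2.
  apply: (F4_bounded_terminates (c2 := c1) (t2 := t1) (k2 := k1) (y := x)
            k2_ge1 c2_neq) => m.
  by rewrite -F4_termC; apply: bnd.
have [N1 [D1 [D1t D1_pred van1]]] := F4_terminates_domain k1_ge1 term1.
have [N2 [D2 [D2t D2_pred van2]]] := F4_terminates_domain k2_ge1 term2.
pose N := maxn N1 N2; pose w := F4_coef a b c1 c2 x y.
have w1_eq0 s m n : D1 s -> (N <= m)%N -> w m n * falling s (m * k1) = 0.
  by rewrite geq_max => D1s /andP[le_Nm _]; apply: van1.
have w2_eq0 s m n : D2 s -> (N <= n)%N -> w m n * falling s (n * k2) = 0.
  by rewrite geq_max /w F4_coefC => D2s /andP[_ le_Nn]; apply: van2.
have F_w : expands k1 k2 N D1 D2 F w by apply: F4_expands.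
split.
  apply: (F4_op1_expands_eq0 D1_pred D2_pred _ _ F_w) => //; try exact: k_neq0.
    by move=> m n; apply: F4_coef_rec.
  by move=> n; rewrite mulrA w1_eq0 // mul0r.
rewrite F4_op2_swap.
apply: (F4_op1_expands_eq0 D2_pred D1_pred _ _ (expands_swap F_w)) => //;
  try exact: k_neq0.
  by move=> n m; rewrite /w !(F4_coefC _ _ c1); apply: F4_coef_rec.
by move=> m; rewrite (mulrC (falling t2 _)) mulrCA w2_eq0 // mulr0.
Qed.
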